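(* Let $d\ge2$ and let $A_d^{(d-1)}$ be the $d\times(d+1)$ integer matrix whose entry in row $i$ and column $j$ is $\binom{j}{i}$, for $0\le i\le d-1$ and $0\le j\le d$. Then the toric variety $X_{A_d^{(d-1)}}\subset\mathbb{P}^d$ is a toric hypersurface of degree $2^{d-1}$.
   Context: $\mathbb{P}^d$ is complex projective $d$-space. For an integer matrix $C$ with columns $(1,\mathbf{c}_0),\dots,(1,\mathbf{c}_d)$, $\mathbf{c}_j\in\mathbb{Z}^n$, the projective toric variety $X_C\subset\mathbb{P}^d$ is the Zariski closure of the image of the map $(\mathbb{C}^* )^n\to\mathbb{P}^d$, $\mathbf{t}\mapsto(\mathbf{t}^{\mathbf{c}_0}:\cdots:\mathbf{t}^{\mathbf{c}_d})$, where $\mathbf{t}^{\mathbf{c}}=\prod_i t_i^{c_i}$. Conventions: $\binom{j}{0}=1$, and $\binom{j}{i}=0$ for $j<i$. ($X_{A_d^{(d-1)}}$ is the $(d-1)$th toric interpolant of the rational normal curve $t\mapsto(1:t:\cdots:t^d)$.) *)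

(* Defs.v *)
From HB Require Import structures.
From mathcomp Require Import all_boot all_order all_algebra.
From mathcomp Require Import mpoly complex.
From mathcomp Require Import reals.

Set Implicit Arguments.
Unset Strict Implicit.
Unset Printing Implicit Defensive.

Import GRing.Theory.
Local Open Scope ring_scope.

(* A point of P^d is a line through the origin of K^(d+1). *)
Definition projective_space (K : fieldType) (d : nat) : Type :=
  {L : {vspace 'rV[K]_d.+1} | \dim L == 1%N}.

Section ProjectiveGeometry.

Variables (K : fieldType) (d : nat).
Implicit Types (f : {mpoly K[d.+1]}) (p : projective_space K d).
Implicit Types (X Z : projective_space K d -> Prop).

Definition vanishes_at f p : Prop :=
  forall v : 'rV[K]_d.+1, v \in val p -> f.@[fun i => v 0 i] = 0.

Definition zariski_closed Z : Prop :=
  exists E : {mpoly K[d.+1]} -> Prop,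
    (forall f, E f -> exists k : nat, f \is k.-homog) /\
    (forall p, Z p <-> (forall f, E f -> vanishes_at f p)).

Definition zariski_closure X : projective_space K d -> Prop :=
  fun p => forall Z, zariski_closed Z -> (forall q, X q -> Z q) -> Z p.

Definition mpoly_irreducible f : Prop :=
  [/\ f != 0, f \isn't a GRing.unit &
      forall g h : {mpoly K[d.+1]}, f = g * h ->
        g \is a GRing.unit \/ h \is a GRing.unit].

(* An (irreducible) hypersurface is the zero locus of an irreducible form and
   its degree is the degree of that form; over an algebraically closed field
   the form is unique up to a nonzero scalar by the Nullstellensatz. *)
Definition hypersurface_of_degree X (k : nat) : Prop :=
  exists F : {mpoly K[d.+1]},
    [/\ mpoly_irreducible F, F \is k.-homog &
        forall p, X p <-> vanishes_at F p].

End ProjectiveGeometry.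

(* The columns of C are meant to be (1, c_j): row 0 of C plays no role in the
   parametrization, and row i.+1 gives the exponents of t_i. *)
Definition toric_monomials (K : fieldType) (n d : nat)
    (C : 'M[int]_(n.+1, d.+1)) (t : 'rV[K]_n) : 'rV[K]_d.+1 :=
  \row_j \prod_(i < n) t 0 i ^ C (lift ord0 i) j.

Definition torus_image (K : fieldType) (n d : nat)
    (C : 'M[int]_(n.+1, d.+1)) : projective_space K d -> Prop :=
  fun p => exists t : 'rV[K]_n,
    (forall i, t 0 i != 0) /\ val p = <[toric_monomials C t]>%VS.

Definition toric_variety (K : fieldType) (n d : nat)
    (C : 'M[int]_(n.+1, d.+1)) : projective_space K d -> Prop :=
  zariski_closure (torus_image C).

(* A_d^(k), with rows 0..k and columns 0..d. *)
Definition interpolant_matrix (d k : nat) : 'M[int]_(k.+1, d.+1) :=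
  \matrix_(i, j) ('C(j, i))%:Z.

Arguments toric_variety K {n d} C p.

(* Main.v *)
(* The columns of the binomial matrix satisfy one relation, given by the
   coefficients of (1 - Y)^d: the hypersurface is F = 0, where F is the product
   of the X_j^C(d,j) over even j minus the same product over odd j.

   F is irreducible because it has degree 1 in X_0 and its two monomials are
   coprime.  On the torus, unitriangularity of (C(j,i)) writes every point as
   v_j = prod_(i <= d) t_i^C(j,i), and F(v) = 0 says exactly that t_d = 1.  A
   point of F = 0 on a coordinate hyperplane is reached by a monomial curve
   inside F = 0 whose other points lie in the torus, so a form vanishing on the
   torus image vanishes on F = 0. *)

Require Import Defs.
From mathcomp Require Import all_boot all_order all_algebra.
From mathcomp Require Import mpoly complex.
From mathcomp Require Import reals.

Set Implicit Arguments.
Unset Strict Implicit.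
Unset Printing Implicit Defensive.

Import Order.TTheory GRing.Theory Num.Theory.
Local Open Scope ring_scope.

(** * Irreducibility of a binomial of degree 1 in one variable *)

Lemma size2_factor (R : idomainType) (p g h : {poly R}) :
  size p = 2%N -> p = g * h -> size g = 1%N \/ size h = 1%N.
Proof.
move=> s2 e; have : g * h != 0 by rewrite -e -size_poly_eq0 s2.
rewrite mulf_eq0 negb_or => /andP[g0 h0]; move: s2; rewrite e size_mul //.
move: g0 h0; rewrite -!size_poly_gt0.
case: (size g) => [|[|k]] //; first by left.
case: (size h) => [|[|l]] //; first by right.
by rewrite !addSn !addnS.
Qed.

Lemma coef_linear_factor (R : nzRingType) (p q c : R) (g : {poly R}) :
  p%:P * 'X - q%:P = g * c%:P -> g`_1 * c = p /\ - g`_0 * c = q.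
Proof.
move=> e; rewrite mulNr -!coefMC -e.
by rewrite !coefB !coefMX !coefC /= subr0 sub0r opprK.
Qed.

(** The new variable records the degree in [X_i], while [X_i] itself stays in the coefficients:
    evaluation at 1 recovers the polynomial, and the ring of coefficients is still [{mpoly
    K[n]}]. *)
Definition grade (K : fieldType) (n : nat) (i : 'I_n) :
    {mpoly K[n]} -> {poly {mpoly K[n]}} :=
  mmap (polyC \o @mpolyC n K) (fun j => ('X_j)%:P * 'X^(j == i)).

Lemma gradeM (K : fieldType) (n : nat) (i : 'I_n) (p q : {mpoly K[n]}) :
  grade i (p * q) = grade i p * grade i q.
Proof. by rewrite /grade rmorphM. Qed.

Lemma gradeX (K : fieldType) (n : nat) (i : 'I_n) (m : 'X_{1..n}) :
  grade i ('X_[K, m]) = ('X_[m])%:P * 'X^(m i).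
Proof.
rewrite /grade mmapX /mmap1 (eq_bigr (fun j =>
  (('X_j : {mpoly K[n]})^+ m j)%:P * 'X^((j == i) * m j))); last first.
  by move=> j _; rewrite exprMn rmorphXn -exprM.
rewrite big_split /= -rmorph_prod /= -mpolyXE_id; congr (_ * _).
rewrite (bigD1 i) //= eqxx mul1n big1 ?mulr1 // => j /negPf ->.
by rewrite mul0n.
Qed.

Lemma grade1 (K : fieldType) (n : nat) (i : 'I_n) (p : {mpoly K[n]}) :
  (grade i p).[1] = p.
Proof.
rewrite [in RHS](mpolyE p) /grade /mmap horner_sum.
apply: eq_bigr => m _; rewrite hornerM hornerC /= mul_mpolyC; congr (_ *: _).
rewrite /mmap1 horner_prod mpolyXE_id; apply: eq_bigr => j _.
by rewrite horner_exp hornerM hornerC hornerXn expr1n mulr1.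
Qed.

Lemma mpolyX_neq0 (K : fieldType) (n : nat) (m : 'X_{1..n}) :
  'X_[K, m] != 0.
Proof. by rewrite -msupp_eq0 msuppX. Qed.

Lemma unit_mpoly_mlead0 (K : fieldType) (n : nat) (p : {mpoly K[n]}) :
  p != 0 -> mlead p = 0%MM -> p \is a GRing.unit.
Proof.
move=> p0 lp; have := mlead_deg p0; rewrite lp mdeg0 => /esym/eqP.
case/msize_poly1P => c c0 ->.
by apply: rmorph_unit; rewrite unitfE.
Qed.

(* A factor of degree 0 in X_i divides both monomials, so its leading monomial
   divides two coprime monomials. *)
Lemma binomial_factor_unit (K : fieldType) (n : nat) (i : 'I_n)
    (a b : 'X_{1..n}) (g h : {mpoly K[n]}) :
  a i = 1%N -> b i = 0%N -> (forall j, a j = 0%N \/ b j = 0%N) ->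
  'X_[a] - 'X_[b] = g * h -> size (grade i h) = 1%N -> h \is a GRing.unit.
Proof.
move=> ai bi ab eF /eqP/size_poly1P[c c0 eh].
have hc : h = c by rewrite -(grade1 i h) eh hornerC.
have eG : ('X_[a])%:P * 'X - ('X_[b])%:P = grade i g * c%:P :> {poly {mpoly K[n]}}.
  rewrite -eh -gradeM -eF /grade rmorphB /=.
  by rewrite -/(grade i _) -/(grade i 'X_[b]) !gradeX ai bi expr0 expr1 mulr1.
have main (m : 'X_{1..n}) (q : {mpoly K[n]}) : q * c = 'X_[m] -> (mlead c <= m)%MM.
  move=> e; have q0 : q != 0.
    by apply: contra_eq_neq e => ->; rewrite mul0r eq_sym; exact: mpolyX_neq0.
  by rewrite -(mleadXm K m) -e mleadM //; apply/mnm_lepP => j; rewrite mnmDE leq_addl.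
have [/main la /main lb] := coef_linear_factor eG.
rewrite hc; apply: unit_mpoly_mlead0 => //; apply/mnmP => j; rewrite mnm0E.
apply/eqP; rewrite -leqn0.
have := conj (mnm_lepP la j) (mnm_lepP lb j).
by case: (ab j) => -> [].
Qed.

Lemma binomial_irreducible (K : fieldType) (d : nat) (i : 'I_d.+1)
    (a b : 'X_{1..d.+1}) :
  a i = 1%N -> b i = 0%N -> (forall j, a j = 0%N \/ b j = 0%N) ->
  mpoly_irreducible ('X_[K, a] - 'X_[b]).
Proof.
move=> ai bi ab.
have a0 : a != 0%MM by apply: contra_eq_neq ai => ->; rewrite mnm0E.
have nab : b != a by apply: contra_eq_neq ai => <-; rewrite bi.
(* A coefficient 1 at a nontrivial monomial rules out both zero and the constants. *)
have ca : ('X_[K, a] - 'X_[b])@_a = 1.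
  by rewrite mcoeffB !mcoeffX eqxx (negPf nab) subr0.
split.
- by apply: contra_eq_neq ca => ->; rewrite mcoeff0 eq_sym oner_eq0.
- apply/negP => /andP[/eqP e _]; move: ca; rewrite e mcoeffC (negPf a0).
  by rewrite mulr0 => /esym/eqP; rewrite oner_eq0.
move=> g h e.
have s2 : size (grade i ('X_[K, a] - 'X_[b])) = 2%N.
  rewrite /grade rmorphB /= -/(grade i _) -/(grade i 'X_[b]) !gradeX ai bi.
  rewrite expr0 expr1 mulr1 -polyCN size_MXaddC polyC_eq0 (negPf (mpolyX_neq0 _ _)) /=.
  by rewrite size_polyC (mpolyX_neq0 K a).
have eG : grade i ('X_[K, a] - 'X_[b]) = grade i g * grade i h.
  by rewrite e gradeM.
have [sg|sh] := size2_factor s2 eG.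
  by left; apply: (binomial_factor_unit ai bi ab (g := h)) sg; rewrite mulrC.
by right; apply: (binomial_factor_unit ai bi ab e).
Qed.

(** * The relation between the columns and the degree of the form *)

Definition parity_mon (b : bool) (d : nat) : 'X_{1..d.+1} :=
  [multinom (if odd j == b then 'C(d, j) else 0)%N | j < d.+1].

Lemma coef_addX1_exp (n i : nat) :
  (('X + 1 : {poly int}) ^+ n)`_i = 'C(n, i)%:R.
Proof.
rewrite exprD1n coef_sum.
under eq_bigr do rewrite coefMn coefXn.
have [le_in|lt_ni] := ltnP i n.+1.
  rewrite (bigD1 (Ordinal le_in)) //= eqxx big1 ?addr0 // => j ji.
  rewrite (_ : (i == j) = false) ?mul0rn //.
  by apply: contraNF ji => /eqP ij; apply/eqP/val_inj.
rewrite bin_small // big1 // => j _.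
by rewrite gtn_eqF ?mul0rn // (leq_trans (ltn_ord j)).
Qed.

(* Coefficients of [(1 - (1 + Y))^d = (-Y)^d]. *)
Lemma alternating_bin_mul_bin (d i : nat) :
  \sum_(j < d.+1) (-1) ^+ j * ('C(j, i) * 'C(d, j))%:R =
    (-1) ^+ d * (i == d)%:R :> int.
Proof.
have := exprBn (1 : {poly int}) ('X + 1) d.
rewrite opprD addrCA subrr addr0 [(- 'X) ^+ _]exprNn => /(congr1 (fun p : {poly int} => p`_i)).
have eN k : (-1) ^+ k = ((-1) ^+ k)%:P :> {poly int} by rewrite polyC_exp polyCN.
rewrite eN coefCM coefXn => ->; rewrite coef_sum; apply: eq_bigr => j _.
by rewrite expr1n mulr1 coefMn eN coefCM coef_addX1_exp -mulrnAr natrM mulr_natr.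
Qed.

(** The alternating sum is [(-1) ^+ d] at [i = d] and 0 elsewhere. The correction stands on the side
    dictated by its sign, so that the identity lives in [nat]. *)
Lemma parity_mon_sum (d i : nat) :
  (\sum_(j < d.+1) 'C(j, i) * parity_mon false d j + (i == d) * odd d =
   \sum_(j < d.+1) 'C(j, i) * parity_mon true d j + (i == d) * ~~ odd d)%N.
Proof.
apply/eqP; rewrite -(eqr_nat int) !natrD !natr_sum -subr_eq0 opprD addrACA.
rewrite -sumrB (eq_bigr (fun j : 'I_d.+1 =>
  (-1) ^+ j * ('C(j, i) * 'C(d, j))%:R)); last first.
  move=> j _; rewrite !mnmE -signr_odd; case: (odd j) => /=.
    by rewrite muln0 sub0r expr1 mulN1r.
  by rewrite muln0 subr0 expr0 mul1r.
rewrite alternating_bin_mul_bin -signr_odd.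
by case: (i == d); case: (odd d).
Qed.

(** The relation at [i = 0] makes the two degrees equal, and they add up to a full row of Pascal's
    triangle. The successor matters: in row 0 the degrees are 1 and 0. *)
Lemma mdeg_parity_mon (b : bool) (d : nat) :
  mdeg (parity_mon b d.+1) = (2 ^ d)%N.
Proof.
have e : mdeg (parity_mon false d.+1) = mdeg (parity_mon true d.+1).
  have := parity_mon_sum d.+1 0; rewrite /= !addn0 !mdegE.
  by under eq_bigr do rewrite bin0 mul1n; under [in RHS]eq_bigr do rewrite bin0 mul1n.
have : (mdeg (parity_mon false d.+1) + mdeg (parity_mon true d.+1) = 2 * 2 ^ d)%N.
  rewrite -expnS (Pascal 1 1) !mdegE -big_split /=; apply: eq_bigr => j _.
  by rewrite !mnmE !exp1n !muln1; case: (odd j); rewrite /= ?addn0.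
rewrite e addnn -mul2n => /eqP; rewrite eqn_pmul2l // => /eqP.
by case: b; rewrite ?e.
Qed.

(** * Binomial parametrization of the torus *)

Lemma binomial_param (K : fieldType) (v : nat -> K) (n : nat) :
  (forall j, v j != 0) ->
  exists t : nat -> K, (forall i, t i != 0) /\
    forall j, (j < n)%N -> v j = \prod_(i < n) t i ^+ 'C(j, i).
Proof.
move=> v0; elim: n => [|n [t [t0 tv]]]; first by exists v.
have t1 : \prod_(i < n) t i ^+ 'C(n, i) != 0.
  by apply/prodf_neq0 => i _; rewrite expf_neq0.
(* Forward substitution: [t n] enters the equation for [v n] with exponent 1, so no root is
   extracted, and it enters the earlier equations with exponent 0. *)
exists (fun i => if i == n then v n / \prod_(i < n) t i ^+ 'C(n, i) else t i).
split=> [i|j].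
  by case: ifP => // _; rewrite mulf_neq0 // invr_eq0.
rewrite big_ord_recr /= eqxx.
under eq_bigr => i _ do rewrite ltn_eqF //.
rewrite ltnS leq_eqVlt => /predU1P[->|lt_jn].
  by rewrite binn expr1 mulrC divfK.
by rewrite bin_small // expr0 mulr1 tv.
Qed.

Lemma meval_binomial_param (K : fieldType) (d : nat) (t : nat -> K)
    (m : 'X_{1..d.+1}) :
  'X_[m].@[fun j => \prod_(i < d.+1) t i ^+ 'C(j, i)] =
    \prod_(i < d.+1) t i ^+ (\sum_(j < d.+1) 'C(j, i) * m j).
Proof.
rewrite mevalX (eq_bigr (fun j : 'I_d.+1 =>
  \prod_(i < d.+1) t i ^+ ('C(j, i) * m j))); last first.
  by move=> j _; rewrite -prodrXl; apply: eq_bigr => i _; rewrite exprM.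
rewrite exchange_big; apply: eq_bigr => i _.
by rewrite prodrXr.
Qed.

(** The exponents of [t i] in the two monomials agree for [i < d] and differ by one for [i = d]; the
    parity of [d] decides which is larger. *)
Lemma meval_parity_mon_param (K : fieldType) (d : nat) (t : nat -> K) :
  let v (j : 'I_d.+1) := \prod_(i < d.+1) t i ^+ 'C(j, i) in
  'X_[parity_mon false d].@[v] * t d ^+ odd d =
  'X_[parity_mon true d].@[v] * t d ^+ ~~ odd d.
Proof.
rewrite /= !meval_binomial_param.
rewrite [X in X * _ = _]big_ord_recr [X in _ = X * _]big_ord_recr /=.
rewrite -!mulrA -!exprD.
congr (_ * _).
  apply: eq_bigr => i _; have := parity_mon_sum d i.
  by rewrite ltn_eqF // !addn0 => ->.
by have := parity_mon_sum d d; rewrite eqxx !mul1n => ->.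
Qed.

(** * Density of the torus points in a binomial hypersurface *)

Lemma poly_eq0_of_eval (K : numFieldType) (p : {poly K}) :
  (forall s, s != 0 -> p.[s] = 0) -> p = 0.
Proof.
(* The integers from 1 to [size p] are nonzero and distinct in characteristic 0: too many roots. *)
move=> p0; pose rs := [seq (i.+1)%:R : K | i <- iota 0 (size p)].
apply: (@roots_geq_poly_eq0 _ _ rs).
- by apply/allP => _ /mapP[i _ ->]; rewrite /root p0 // pnatr_eq0.
- rewrite map_inj_uniq ?iota_uniq // => i j /eqP.
  by rewrite eqr_nat eqSS => /eqP.
by rewrite size_map size_iota.
Qed.

(* A point of the hypersurface with vanishing coordinates is the limit at s = 0
   of points u_j * s^(e_j) of the hypersurface lying in the torus; the weights
   e_j of the vanishing coordinates balance the degrees of the two monomials. *)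
Lemma binomial_torus_dense (K : numClosedFieldType) (n : nat)
    (a b : 'X_{1..n}) (f : {mpoly K[n]}) :
  (forall j, (a j == 0)%N = (b j != 0)%N) ->
  (forall w, (forall j, w j != 0) -> 'X_[a].@[w] = 'X_[b].@[w] -> f.@[w] = 0) ->
  forall v, 'X_[a].@[v] = 'X_[b].@[v] -> f.@[v] = 0.
Proof.
move=> ab f0 v vab.
have [v0|] := boolP [forall j, v j != 0]; first by apply: f0 => // j; exact: (forallP v0).
rewrite negb_forall => /existsP[j0]; rewrite negbK => vj0.
(* [X_j0] divides one monomial, and the two values agree, so both vanish; hence each monomial
   contains a vanishing coordinate, [k] for [a] and [l] for [b]. *)
have a0 : 'X_[a].@[v] = 0.
  have [aj|aj] := eqVneq (a j0) 0%N; [rewrite vab|]; rewrite mevalX (bigD1 j0) //=.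
    by rewrite (eqP vj0) expr0n; move: (ab j0); rewrite aj eqxx => /esym/negPf ->; rewrite mul0r.
  by rewrite (eqP vj0) expr0n (negPf aj) mul0r.
have /eqP := a0; rewrite mevalX => /prodf_eq0[k _].
rewrite expf_eq0 => /andP[ak vk].
have /eqP := a0; rewrite vab mevalX => /prodf_eq0[l _].
rewrite expf_eq0 => /andP[bl vl].
pose A := (\sum_(j | v j == 0%R) a j)%N.
pose B := (\sum_(j | v j == 0%R) b j)%N.
have A0 : (0 < A)%N by rewrite /A (bigD1 k) //= ltn_addr.
have B0 : (0 < B)%N by rewrite /B (bigD1 l) //= ltn_addr.
pose u0 j := if v j == 0 then 1 else v j.
have u00 j : u0 j != 0 by rewrite /u0; case: ifPn => //; rewrite oner_eq0.
pose R := (\prod_j u0 j ^+ b j) / \prod_j u0 j ^+ a j.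
have R0 : R != 0.
  by rewrite mulf_neq0 ?invr_eq0 //; apply/prodf_neq0 => j _; rewrite expf_neq0.
(* As [v k = 0], the value of [u] at [k] does not affect the limit; the root is chosen there to make
   both monomials agree at [u]. *)
pose u j := u0 j * (if j == k then (a k).-root R else 1).
have bk : b k = 0%N by apply/eqP; move: (ab k); rewrite eqn0Ngt ak => /esym/negbFE.
have u_neq0 j : u j != 0.
  rewrite mulf_neq0 //; case: ifP => _; last exact: oner_neq0.
  by rewrite rootC_eq0.
have uab : \prod_j u j ^+ a j = \prod_j u j ^+ b j.
  have up (m : 'X_{1..n}) : \prod_j u j ^+ m j =
      \prod_j u0 j ^+ m j * (a k).-root R ^+ m k.
    under eq_bigr do rewrite exprMn.
    rewrite big_split /=; congr (_ * _).
    rewrite (bigD1 k) //= eqxx big1 ?mulr1 // => j /negPf ->.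
    by rewrite expr1n.
  rewrite !up bk expr0 mulr1 rootCK // /R mulrC divfK //.
  by apply/prodf_neq0 => j _; rewrite expf_neq0.
(* With these weights both monomials acquire the factor [s ^+ (A * B)]. *)
pose e j := if v j == 0 then (if a j == 0 then A else B)%N else 0%N.
pose y s j := u j * s ^+ e j.
have y0 j : y 0 j = v j.
  rewrite /y; have [vj|vj] := eqVneq (v j) 0.
    rewrite expr0n (_ : (e j == 0)%N = false) ?mulr0 //.
    by rewrite /e vj eqxx; case: ifP => _; rewrite eqn0Ngt ?A0 ?B0.
  rewrite /e /u /u0 (negPf vj) expr0 mulr1.
  case: eqP => [jk|_]; last by rewrite mulr1.
  by move: vj; rewrite jk (eqP vk) eqxx.
have yE s (m : 'X_{1..n}) : 'X_[m].@[y s] =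
    \prod_j u j ^+ m j * s ^+ (\sum_(j | v j == 0%R) e j * m j).
  rewrite mevalX (eq_bigr (fun j => u j ^+ m j * s ^+ (e j * m j))); last first.
    by move=> j _; rewrite exprMn exprM.
  rewrite big_split /= prodrXr; congr (_ * _ ^+ _).
  rewrite [RHS]big_mkcond; apply: eq_bigr => j _.
  by rewrite /e; case: (v j == 0); rewrite ?mul0n.
have eA : (\sum_(j | v j == 0%R) e j * a j = B * A)%N.
  rewrite /A big_distrr /=; apply: eq_bigr => j vj; rewrite /e vj.
  by case: (a j =P 0%N) => [->|_]; rewrite ?muln0.
have eB : (\sum_(j | v j == 0%R) e j * b j = A * B)%N.
  rewrite /B big_distrr /=; apply: eq_bigr => j vj; rewrite /e vj ab.
  by case: (b j =P 0%N) => [->|_]; rewrite ?muln0.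
pose p := mmap (@polyC K) (fun j => u j *: 'X^(e j)) f.
have pE s : p.[s] = f.@[y s].
  rewrite /p /mmap horner_sum mevalE; apply: eq_bigr => m _.
  rewrite hornerM hornerC /mmap1 horner_prod; congr (_ * _).
  by apply: eq_bigr => j _; rewrite horner_exp hornerZ hornerXn.
have p_eq0 : p = 0.
  apply: poly_eq0_of_eval => s s0; rewrite pE; apply: f0 => [j|].
    by rewrite mulf_neq0 ?expf_neq0.
  by rewrite !yE uab eA eB mulnC.
by rewrite -(meval_eq _ y0) -pE p_eq0 horner0.
Qed.

(** * The torus image and the hypersurface *)

Lemma toric_monomials_neq0 (K : fieldType) (d : nat) (t : 'rV[K]_d) :
  toric_monomials (interpolant_matrix d.+1 d) t != 0.
Proof.
apply/eqP => /rowP/(_ 0); rewrite !mxE big1 => [/eqP|i _].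
  by rewrite oner_eq0.
by rewrite mxE bin_small.
Qed.

(** Since ['C(j, 0) = 1], [t 0] is the scalar along the line; the torus parameters are [t 1] to
    [t d], hence the shift. *)
Lemma scaled_toric_monomials (K : fieldType) (d : nat) (t : nat -> K)
    (j : 'I_d.+2) :
  t d.+1 = 1 ->
  \prod_(i < d.+2) t i ^+ 'C(j, i) =
  t 0%N * toric_monomials (interpolant_matrix d.+1 d) (\row_i t i.+1) 0 j.
Proof.
move=> td; rewrite big_ord_recr /= td expr1n mulr1 big_ord_recl bin0 expr1.
by rewrite !mxE; congr (_ * _); apply: eq_bigr => i _; rewrite !mxE.
Qed.

Lemma torus_image_vanishes (K : fieldType) (d : nat)
    (p : projective_space K d.+1) :
  torus_image (interpolant_matrix d.+1 d) p ->
  vanishes_at ('X_[parity_mon false d.+1] - 'X_[parity_mon true d.+1]) p.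
Proof.
case=> t [t0 ep] v; rewrite ep => /vlineP[c ->].
(* The sequence is [c], then the entries of [t], then 1, the default of [oapp] once [insub] fails.
   The scalar [c] may be 0. *)
have [t' [t'0 t'd et]] : exists t' : nat -> K,
    [/\ t' 0%N = c, t' d.+1 = 1 & \row_i t' i.+1 = t].
  exists (fun i => if i is i'.+1 then oapp (t 0) 1 (insub i') else c).
  split=> //; first by rewrite insubN // ltnn.
  by apply/rowP => i; rewrite mxE valK.
rewrite (meval_eq (v2 := fun j : 'I_d.+2 => \prod_(i < d.+2) t' i ^+ 'C(j, i)));
  last by move=> j; rewrite scaled_toric_monomials // et t'0 mxE.
rewrite mevalB; have := meval_parity_mon_param d.+1 t'.
by rewrite /= t'd !expr1n !mulr1 => ->; rewrite subrr.
Qed.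

Lemma torus_point_in_image (K : fieldType) (d : nat) (v : 'I_d.+2 -> K) :
  (forall j, v j != 0) ->
  'X_[parity_mon false d.+1].@[v] = 'X_[parity_mon true d.+1].@[v] ->
  exists2 p : projective_space K d.+1,
    torus_image (interpolant_matrix d.+1 d) p & (\row_j v j) \in val p.
Proof.
move=> v0 ev.
have [t [t0 tv]] := binomial_param d.+2 (fun j => v0 (inord j)).
have vE j : v j = \prod_(i < d.+2) t i ^+ 'C(j, i).
  by rewrite -tv // inord_val.
(* Cancelling the common nonzero monomial value leaves [t d.+1] on one side and 1 on the other. *)
have td : t d.+1 = 1.
  have X0 : 'X_[parity_mon true d.+1].@[v] != 0.
    by rewrite mevalX; apply/prodf_neq0 => j _; rewrite expf_neq0.
  have := meval_parity_mon_param d.+1 t.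
  rewrite /= -!(meval_eq _ vE) ev => /(mulfI X0).
  by case: (odd d); rewrite /= expr0 expr1.
pose r : 'rV[K]_d := \row_i t i.+1.
have dim1 : \dim <[toric_monomials (interpolant_matrix d.+1 d) r]> == 1%N.
  by rewrite dim_vline toric_monomials_neq0.
exists (exist (fun L : {vspace 'rV[K]_d.+2} => \dim L == 1%N) _ dim1); first by exists r; split=> // i; rewrite mxE.
apply/vlineP; exists (t 0%N); apply/rowP => j.
by rewrite !mxE vE scaled_toric_monomials // mxE.
Qed.

Theorem proposition3p2 (R : realType) (d : nat) (hd : (2 <= d)%N) :
  hypersurface_of_degree
    (toric_variety R[i]%C (interpolant_matrix d d.-1)) (2 ^ (d - 1)).
Proof.
case: d hd => [//|d] _; rewrite subn1 /=; set K := R[i]%C.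
pose F : {mpoly K[d.+2]} := 'X_[parity_mon false d.+1] - 'X_[parity_mon true d.+1].
have F_homog : F \is (2 ^ d).-homog.
  by apply: rpredB; rewrite dhomogX /= mdeg_parity_mon.
exists F; split=> //.
  apply: (@binomial_irreducible _ _ ord0); rewrite ?mnmE //= ?bin0 // => j.
  by rewrite !mnmE; case: (odd j); [left | right].
move=> p; split=> [|Fp Z [E [E_homog ZE]] imZ].
  (* The locus of [F] is itself a closed set containing the torus image. *)
  apply; last exact: torus_image_vanishes.
  exists (eq F); split=> [f <-|q]; first by exists (2 ^ d)%N.
  by split=> [Fq f <-|]; [|apply].
apply/ZE => f Ef v vp.
apply: (@binomial_torus_dense _ _ (parity_mon false d.+1) (parity_mon true d.+1)).
(* As [j <= d.+1], the binomial coefficient is positive, so each coordinate occurs in exactly one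
   monomial. *)
- move=> j; rewrite !mnmE; case: (odd j) => /=; rewrite ?eqxx //.
    by rewrite -lt0n bin_gt0 -ltnS ltn_ord.
  by rewrite -leqn0 leqNgt bin_gt0 -ltnS ltn_ord.
- move=> w w0 ew; have [q iq wq] := torus_point_in_image w0 ew.
  rewrite -((ZE q).1 (imZ q iq) f Ef _ wq); apply: meval_eq => j.
  by rewrite mxE.
by apply/eqP; rewrite -subr_eq0 -mevalB; apply/eqP/Fp.
Qed.
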